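(* For any two words $w_1,w_2$ over the alphabet $\mathcal{G}$ we have $$w_1\sim w_2 \iff w_1\equiv w_2 ,$$ where $\sim$ and $\equiv$ are the relations defined in the context (i.e. $w_1$ and $w_2$ occupy the same place in two isomorphic connected components of the crystal $\Gamma$ if and only if they are equal in the plactic monoid $Pl(G_2)$).
   Context: Let $\mathcal{G}=\{1,2,3,0,\bar3,\bar2,\bar1\}$, totally ordered by $1\prec2\prec3\prec0\prec\bar3\prec\bar2\prec\bar1$. Let $B(\Lambda_1)$ be the crystal (for $U_q(G_2)$, with Dynkin nodes $1$ (short root) and $2$ (long root)) whose vertices are the letters of $\mathcal{G}$ and whose only arrows are $1\xrightarrow{1}2\xrightarrow{2}3\xrightarrow{1}0\xrightarrow{1}\bar3\xrightarrow{2}\bar2\xrightarrow{1}\bar1$, where $a\xrightarrow{i}b$ means $\tilde f_i(a)=b$ and $\tilde e_i(b)=a$; all other applications of $\tilde e_i,\tilde f_i$ ($i=1,2$) give $0$. For a crystal vertex $u$ put $\varepsilon_i(u)=\max\{k:\tilde e_i^k u\neq0\}$, $\varphi_i(u)=\max\{k:\tilde f_i^ku\neq0\}$. A word $x_1\cdots x_l$ over $\mathcal{G}$ (including the empty word) is identified with the vertex $x_1\otimes\cdots\otimes x_l$ of $\Gamma=\bigoplus_{l\ge0}B(\Lambda_1)^{\otimes l}$, where Kashiwara operators act on tensor products by: $\tilde f_i(u\otimes v)=\tilde f_i(u)\otimes v$ if $\varphi_i(u)>\varepsilon_i(v)$ and $=u\otimes\tilde f_i(v)$ if $\varphi_i(u)\le\varepsilon_i(v)$;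 $\tilde e_i(u\otimes v)=u\otimes\tilde e_i(v)$ if $\varphi_i(u)<\varepsilon_i(v)$ and $=\tilde e_i(u)\otimes v$ if $\varphi_i(u)\ge\varepsilon_i(v)$. For a word $w$, $B(w)$ denotes the connected component of the crystal graph $\Gamma$ containing $w$; each connected component has a unique highest weight vertex (a vertex killed by $\tilde e_1,\tilde e_2$), so crystal isomorphisms between connected components are unique when they exist. The relation $\sim$: $w_1\sim w_2$ iff there is a crystal isomorphism $B(w_1)\to B(w_2)$ (a bijection commuting with all $\tilde e_i,\tilde f_i$) sending $w_1$ to $w_2$. The relation $\equiv$ (the plactic monoid $Pl(G_2)=\mathcal{G}^*/\equiv$): $\equiv$ is the smallest congruence on the free monoid $\mathcal{G}^*$ (equivalence relation compatible with concatenation on both sides) containing (R1) $10\equiv1,\ 1\bar3\equiv2,\ 1\bar2\equiv3,\ 2\bar2\equiv0,\ 0\bar1\equiv\bar1,\ 3\bar1\equiv\bar2,\ 2\bar1\equiv\bar3$; (R2) $1\bar1\equiv\emptyset$ (the empty word); (R3) $u\equiv\xi_3(u)$ for every $u\in B(121)$, where $\xi_3:B(121)\to B(112)$ is the crystal isomorphism; (R4) $u\equiv\xi_4(u)$ for every $u\in B(123)$, where $\xi_4:B(123)\to B(110)$ is the crystal isomorphism (the components $B(121)\cong B(112)$ and $B(123)\cong B(110)$ are isomorphic crystals). *)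

(* Defs.v *)
(* Built on MathComp. *)
From Stdlib Require Import Relations.
From mathcomp Require Import all_boot.
Set Implicit Arguments.
Unset Strict Implicit.
Unset Printing Implicit Defensive.

(* A trailing [b] stands for a bar. *)
Inductive letter := g1 | g2 | g3 | g0 | g3b | g2b | g1b.

Definition word := seq letter.

(* [node1] is the short root of G2, [node2] the long one. *)
Inductive node := node1 | node2.

(* Kashiwara operators are partial functions: [None] is the value 0. *)
Definition letter_f (i : node) (a : letter) : option letter :=
  match i, a with
  | node1, g1 => Some g2
  | node2, g2 => Some g3
  | node1, g3 => Some g0
  | node1, g0 => Some g3b
  | node2, g3b => Some g2b
  | node1, g2b => Some g1b
  | _, _ => None
  end.

Definition letter_e (i : node) (b : letter) : option letter :=
  match i, b with
  | node1, g2 => Some g1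
  | node2, g3 => Some g2
  | node1, g0 => Some g3
  | node1, g3b => Some g0
  | node2, g2b => Some g3b
  | node1, g1b => Some g2b
  | _, _ => None
  end.

Lemma letter_efP i a b : letter_f i a = Some b <-> letter_e i b = Some a.
Proof. by case: i; case: a; case: b. Qed.

(* max {k <= n | g^k u <> 0}.  Below, [n] is always large enough for the bound
   k <= n to be redundant: see [epsP] and [phiP]. *)
Fixpoint string_length (T : Type) (g : T -> option T) (n : nat) (u : T) : nat :=
  match n, g u with
  | n'.+1, Some u' => (string_length g n' u').+1
  | _, _ => 0
  end.

(* The operators on the l-th tensor power of B(Lambda_1), seen as the letter
   crystal tensored with the (l-1)-th power; they are meant for words of size l.
   An i-string has at most 3 vertices in B(Lambda_1), hence at most 2l+1 in the
   l-th power, which explains the bounds given to [string_length]. *)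
Fixpoint tensor_e (l : nat) (i : node) (w : word) : option word :=
  match l, w with
  | l'.+1, x :: v =>
      if string_length (letter_f i) 2 x
           < string_length (tensor_e l' i) (2 * l') v
      then omap (cons x) (tensor_e l' i v)
      else omap (cons^~ v) (letter_e i x)
  | _, _ => None
  end.

Fixpoint tensor_f (l : nat) (i : node) (w : word) : option word :=
  match l, w with
  | l'.+1, x :: v =>
      if string_length (letter_f i) 2 x
           > string_length (tensor_e l' i) (2 * l') v
      then omap (cons^~ v) (letter_f i x)
      else omap (cons x) (tensor_f l' i v)
  | _, _ => None
  end.

Definition et (i : node) (w : word) : option word := tensor_e (size w) i w.
Definition ft (i : node) (w : word) : option word := tensor_f (size w) i w.

Definition eps (i : node) (w : word) : nat :=
  string_length (et i) (2 * size w) w.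
Definition phi (i : node) (w : word) : nat :=
  string_length (ft i) (2 * size w) w.

Lemma string_lengthP (T : Type) (g : T -> option T) (h : T -> nat) :
    (forall u u', g u = Some u' -> h u' < h u) ->
  forall n u k, h u <= n ->
  isSome (iter k (obind g) (Some u)) = (k <= string_length g n u).
Proof.
move=> hg; have iterN k : iter k (obind g) None = None by elim: k => //= k ->.
elim=> [|n IHn] u [|k] hu //.
  rewrite iterSr /=; case gu: (g u) => [u'|]; last by rewrite iterN.
  by have := leq_trans (hg _ _ gu) hu.
rewrite iterSr /=; case gu: (g u) => [u'|]; last by rewrite iterN.
by rewrite IHn // -ltnS (leq_trans (hg _ _ gu) hu).
Qed.

(* Number of steps from the top of the i-string of a letter. *)
Definition depth (i : node) (a : letter) : nat :=
  match i, a with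
  | node1, (g2 | g0 | g1b) | node2, (g3 | g2b) => 1
  | node1, g3b => 2
  | _, _ => 0
  end.

Definition wdepth (i : node) (w : word) : nat := sumn (map (depth i) w).

Lemma wdepth_le i w : wdepth i w <= 2 * size w.
Proof.
elim: w => //= x w IH; rewrite /wdepth /= mulnS leq_add //.
by case: i x {IH} => [] [].
Qed.

Lemma tensor_e_depth l i w w' : tensor_e l i w = Some w' ->
  size w' = size w /\ wdepth i w = (wdepth i w').+1.
Proof.
elim: l w w' => [|l IHl] [|x v] w' //=.
case: ifP => _; last first.
  case ex: (letter_e i x) => [y|] //= [<-]; split=> //.
  by rewrite /wdepth /= -addSn; congr (_ + _); case: i x y ex {IHl} => [] [] [].
case ev: (tensor_e l i v) => [v'|] //= [<-].
have [sv dv] := IHl _ _ ev; split; first by rewrite /= sv.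
by rewrite -[LHS]/(depth i x + wdepth i v) dv addnS.
Qed.

Lemma tensor_f_depth l i w w' : tensor_f l i w = Some w' ->
  size w' = size w /\ wdepth i w' = (wdepth i w).+1.
Proof.
elim: l w w' => [|l IHl] [|x v] w' //=.
case: ifP => _.
  case fx: (letter_f i x) => [y|] //= [<-]; split=> //.
  by rewrite /wdepth /= -addSn; congr (_ + _); case: i x y fx {IHl} => [] [] [].
case fv: (tensor_f l i v) => [v'|] //= [<-].
have [sv dv] := IHl _ _ fv; split; first by rewrite /= sv.
by rewrite -[LHS]/(depth i x + wdepth i v') dv addnS.
Qed.

Lemma epsP i w k :
  isSome (iter k (obind (et i)) (Some w)) = (k <= eps i w).
Proof.
apply: (string_lengthP (h := wdepth i)); last exact: wdepth_le.
by move=> u u' /tensor_e_depth[_ ->].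
Qed.

Lemma phiP i w k :
  isSome (iter k (obind (ft i)) (Some w)) = (k <= phi i w).
Proof.
apply: (string_lengthP (h := fun u => 2 * size u - wdepth i u)).
  move=> u u' /tensor_f_depth[su du]; rewrite su du ltn_sub2l //.
  by rewrite -du -su wdepth_le.
exact: leq_subr.
Qed.

(* The bounded string length of [tensor_e l] is [eps] on words of size l. *)
Lemma tensor_e_eps i v :
  string_length (tensor_e (size v) i) (2 * size v) v = eps i v.
Proof.
rewrite /eps; move: (2 * size v) => n; move def_l: (size v) => l.
elim: n v def_l => //= n IHn v sv; rewrite /et sv.
case ev: (tensor_e l i v) => [v'|] //; congr _.+1; apply: IHn.
by have [-> _] := tensor_e_depth ev.
Qed.

Lemma phi1E i x : string_length (letter_f i) 2 x = phi i [:: x].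
Proof. by case: i x => [] []. Qed.

(* The tensor product rule for x (x) v; the powers of B(Lambda_1) are bracketed
   to the right, which is harmless as the tensor product is associative. *)
Lemma et_cons i x v :
  et i (x :: v) =
    if phi i [:: x] < eps i v then omap (cons x) (et i v)
    else omap (cons^~ v) (letter_e i x).
Proof. by rewrite /et -phi1E -tensor_e_eps. Qed.

Lemma ft_cons i x v :
  ft i (x :: v) =
    if phi i [:: x] > eps i v then omap (cons^~ v) (letter_f i x)
    else omap (cons x) (ft i v).
Proof. by rewrite /ft -phi1E -tensor_e_eps. Qed.

Definition arrow (u v : word) : Prop := exists i, ft i u = Some v.

Definition component (w : word) : word -> Prop :=
  clos_refl_sym_trans word arrow w.

(* [psi] restricts to a crystal isomorphism from A to B; its values outside A
   are irrelevant. *)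
Record crystal_iso (A B : word -> Prop) (psi : word -> word) : Prop := {
  iso_codom : forall u, A u -> B (psi u);
  iso_inj : forall u v, A u -> A v -> psi u = psi v -> u = v;
  iso_surj : forall v, B v -> exists2 u, A u & psi u = v;
  iso_et : forall i u, A u -> et i (psi u) = omap psi (et i u);
  iso_ft : forall i u, A u -> ft i (psi u) = omap psi (ft i u)
}.

Definition crystal_eq (w1 w2 : word) : Prop :=
  exists2 psi, crystal_iso (component w1) (component w2) psi & psi w1 = w2.

Inductive plactic_rel : word -> word -> Prop :=
| R1_1 : plactic_rel [:: g1; g0] [:: g1]
| R1_2 : plactic_rel [:: g1; g3b] [:: g2]
| R1_3 : plactic_rel [:: g1; g2b] [:: g3]
| R1_4 : plactic_rel [:: g2; g2b] [:: g0]
| R1_5 : plactic_rel [:: g0; g1b] [:: g1b]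
| R1_6 : plactic_rel [:: g3; g1b] [:: g2b]
| R1_7 : plactic_rel [:: g2; g1b] [:: g3b]
| R2 : plactic_rel [:: g1; g1b] [::]
| R3 xi u :
    crystal_iso (component [:: g1; g2; g1]) (component [:: g1; g1; g2]) xi ->
    component [:: g1; g2; g1] u ->
    plactic_rel u (xi u)
| R4 xi u :
    crystal_iso (component [:: g1; g2; g3]) (component [:: g1; g1; g0]) xi ->
    component [:: g1; g2; g3] u ->
    plactic_rel u (xi u).

Inductive plactic : word -> word -> Prop :=
| plactic_gen u v : plactic_rel u v -> plactic u v
| plactic_refl u : plactic u u
| plactic_sym u v : plactic u v -> plactic v u
| plactic_trans u v w : plactic u v -> plactic v w -> plactic u w
| plactic_cat u u' v v' :
    plactic u u' -> plactic v v' -> plactic (u ++ v) (u' ++ v').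

(* Main.v *)
Require Import Defs.
From HB Require Import structures.
From mathcomp Require Import all_boot zify.
From Stdlib Require Import Relations ClassicalEpsilon.
Set Implicit Arguments.
Unset Strict Implicit.
Unset Printing Implicit Defensive.

(* The plactic congruence commutes with the Kashiwara operators, because its
   generators come in families stable under them and because the tensor product
   rule only sees lengths of strings, which are then preserved.  Modulo the
   congruence, a highest weight word of weight a Lambda_1 + b Lambda_2 reduces
   to the word (12)^b 1^a, by appending letters one by one; hence words with the
   same place in isomorphic components are congruent.

   The converse needs that every component has a unique highest weight vertex.
   The component of (12)^b 1^a consists of words cut into b blocks of two letters
   and a blocks of one letter, such that two consecutive blocks always lie in the
   component of their highest weight words: this local condition is stable under
   the operators, and a finite check leaves only one highest weight word.  For an
   arbitrary component, let ux and u'x' be two highest weight words in it.  Then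
   u = u' by induction, both words are congruent to the same (12)^b 1^a by the
   previous case, so they have the same weight; as the seven letters have
   distinct weights, x = x'. *)

(** * String lengths and the tensor product rule on concatenations *)

Definition letter_code (a : letter) : nat :=
  match a with
  | g1 => 0 | g2 => 1 | g3 => 2 | g0 => 3 | g3b => 4 | g2b => 5 | g1b => 6
  end.

Definition letter_decode (n : nat) : letter :=
  nth g1b [:: g1; g2; g3; g0; g3b; g2b] n.

Lemma letter_codeK : cancel letter_code letter_decode.
Proof. by case. Qed.

HB.instance Definition _ := Equality.copy letter (can_type letter_codeK).

Definition height (i : node) (a : letter) : nat :=
  match i, a with
  | node1, g3 => 2
  | node1, (g1 | g0 | g2b) | node2, (g2 | g3b) => 1
  | _, _ => 0
  end.

(* The pair (eps_i, phi_i), computed by the signature rule. *)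
Fixpoint sig (i : node) (w : word) : nat * nat :=
  if w is x :: v then
    (depth i x + ((sig i v).1 - height i x),
     (sig i v).2 + (height i x - (sig i v).1))
  else (0, 0).

Lemma phi_letter i x : phi i [:: x] = height i x.
Proof. by case: i x => [] []. Qed.

Lemma sig_cat i u v :
  sig i (u ++ v) = ((sig i u).1 + ((sig i v).1 - (sig i u).2),
                    (sig i v).2 + ((sig i u).2 - (sig i v).1)).
Proof.
elim: u => [|x u IH] /=; first by rewrite subn0 add0n sub0n addn0; case: sig.
by rewrite IH /=; congr pair; lia.
Qed.

Lemma letter_fP i x y : letter_f i x = Some y ->
  [/\ depth i y = (depth i x).+1, height i x = (height i y).+1
    & letter_e i y = Some x].
Proof. by case: i x y => [] [] []. Qed.

Lemma letter_f_None i x : letter_f i x = None -> height i x = 0.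
Proof. by case: i x => [] []. Qed.

Lemma letter_eP i x y : letter_e i x = Some y ->
  [/\ depth i x = (depth i y).+1, height i y = (height i x).+1
    & letter_f i y = Some x].
Proof. by case: i x y => [] [] []. Qed.

Lemma letter_e_None i x : letter_e i x = None -> depth i x = 0.
Proof. by case: i x => [] []. Qed.

(** The clauses need a joint induction on length: the tensor product rule reads [eps] of the tail,
    known to equal its signature only once the clauses hold there. *)
Record string_spec (i : node) (w : word) : Prop := {
  spec_e : forall w', et i w = Some w' ->
    [/\ (sig i w).1 = (sig i w').1.+1, (sig i w').2 = (sig i w).2.+1
      & ft i w' = Some w];
  spec_eN : et i w = None -> (sig i w).1 = 0;
  spec_f : forall w', ft i w = Some w' ->
    [/\ (sig i w').1 = (sig i w).1.+1, (sig i w).2 = (sig i w').2.+1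
      & et i w' = Some w];
  spec_fN : ft i w = None -> (sig i w).2 = 0
}.

Lemma et_size i w w' : et i w = Some w' -> size w' = size w.
Proof. by case/tensor_e_depth. Qed.

Lemma ft_size i w w' : ft i w = Some w' -> size w' = size w.
Proof. by case/tensor_f_depth. Qed.

Lemma spec_eps i n :
  (forall w, size w = n -> string_spec i w) ->
  forall w, size w = n -> eps i w = (sig i w).1.
Proof.
move=> H w sw.
have {}H k : isSome (iter k (obind (et i)) (Some w)) = (k <= (sig i w).1).
  elim: k w sw => [|k IH] w sw //.
  rewrite iterSr /=; case ew: (et i w) => [w'|].
    have [-> _ _] := spec_e (H _ sw) ew.
    by rewrite IH // -sw (et_size ew).
  have -> : iter k (obind (et i)) None = None by elim: k {IH} => //= k ->.
  by rewrite (spec_eN (H _ sw) ew).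
by apply/eqP; rewrite eqn_leq -H -epsP [X in X && _]epsP [X in _ && X]H !leqnn.
Qed.

Lemma string_specP i w : string_spec i w.
Proof.
move def_n: (size w) => n.
elim: n w def_n => [|n IHn] [|x v] //= [sv].
have Ev := spec_eps IHn; have Sv := IHn _ sv.
split; rewrite ?et_cons ?ft_cons /= ?phi_letter ?Ev //.
- move=> w'; case: ifP => cmp.
    case ev: (et i v) => [v'|] //= [<-] /=.
    have [Hv1 Hv2 fv'] := spec_e Sv ev.
    rewrite ft_cons fv' phi_letter Ev ?(et_size ev) //.
    by rewrite ifF; [split=> //; lia | lia].
  case ex: (letter_e i x) => [y|] //= [<-] /=.
  have [dx hy fy] := letter_eP ex.
  rewrite ft_cons fy phi_letter Ev //.
  by rewrite ifT; [split=> //; lia | lia].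
- case: ifP => cmp.
    by case ev: (et i v) => [v'|] //= _; move: (spec_eN Sv ev); lia.
  by case ex: (letter_e i x) => [v'|] //= _; move: (letter_e_None ex); lia.
- move=> w'; case: ifP => cmp.
    case ex: (letter_f i x) => [y|] //= [<-] /=.
    have [dx hy fy] := letter_fP ex.
    rewrite et_cons fy phi_letter Ev //.
    by rewrite ifF; [split=> //; lia | lia].
  case ev: (ft i v) => [v'|] //= [<-] /=.
  have [Hv1 Hv2 fv'] := spec_f Sv ev.
  rewrite et_cons fv' phi_letter Ev ?(ft_size ev) //.
  by rewrite ifT; [split=> //; lia | lia].
- case: ifP => cmp.
    by case ex: (letter_f i x) => [v'|] //= _; move: (letter_f_None ex); lia.
  by case ev: (ft i v) => [v'|] //= _; move: (spec_fN Sv ev); lia.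
Qed.

Lemma epsE i w : eps i w = (sig i w).1.
Proof. by apply: (@spec_eps i (size w)) => // v _; apply: string_specP. Qed.

Lemma etP i u v : et i u = Some v <-> ft i v = Some u.
Proof.
split=> [/(spec_e (string_specP i u))[]|/(spec_f (string_specP i v))[]] //.
Qed.

Lemma et_None i u : et i u = None <-> (sig i u).1 = 0.
Proof.
split=> [/(spec_eN (string_specP i u))//|].
by case eu: (et i u) => [v|] //; have [->] := spec_e (string_specP i u) eu.
Qed.

(** Cancellation in [sig] is associative, which moves the tensor product rule from the first letter
    to any cut. *)
Lemma et_cat i u v :
  et i (u ++ v) =
    if (sig i u).2 < (sig i v).1 then omap (cat u) (et i v)
    else omap (cat^~ v) (et i u).
Proof.
elim: u => [|x u IH] /=.
  by case: ltnP => [_|]; [case: et | rewrite leqn0 => /eqP/et_None ->].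
rewrite !et_cons !epsE sig_cat /= IH phi_letter.
case: (ltnP (sig i u).2) => c1; case: (ltnP (_ + (height i x - _))) => c2.
- by rewrite ifT; [case: et | lia].
- by rewrite !ifF; [case: letter_e | lia | lia].
- lia.
have -> : (sig i u).1 + ((sig i v).1 - (sig i u).2) = (sig i u).1 by lia.
by case: ifP => _; [case: et | case: letter_e].
Qed.

Lemma ft_None i u : ft i u = None <-> (sig i u).2 = 0.
Proof.
split=> [/(spec_fN (string_specP i u))//|].
by case eu: (ft i u) => [v|] //; have [_ ->] := spec_f (string_specP i u) eu.
Qed.

Lemma ft_cat i u v :
  ft i (u ++ v) =
    if (sig i v).1 < (sig i u).2 then omap (cat^~ v) (ft i u)
    else omap (cat u) (ft i v).
Proof.
elim: u => [|x u IH] /=; first by case: ft.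
rewrite !ft_cons !epsE sig_cat /= IH phi_letter.
case: (ltnP (sig i v).1); case: (ltnP _ (_ + (height i x - _))) => c2 c1.
- by case: ltnP => c3; [rewrite ifT; [case: letter_f | lia]
                       |rewrite ifF; [case: ft | lia]].
- lia.
- by rewrite !ifT; [case: letter_f | lia | lia].
- by rewrite ifF; [case: ft | lia].
Qed.

(** * Stability of the plactic congruence under the Kashiwara operators *)

Definition orel (R : word -> word -> Prop) (a b : option word) : Prop :=
  match a, b with
  | Some u, Some v => R u v
  | None, None => True
  | _, _ => False
  end.

(** Equality of [sig] makes the relation pass to concatenations: it decides on which factor an
    operator acts. *)
Record parallel (u v : word) : Prop := {
  par_sig : forall i, sig i u = sig i v;
  par_et : forall i, orel plactic (et i u) (et i v);
  par_ft : forall i, orel plactic (ft i u) (ft i v)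
}.

Lemma component_ft i c u v : ft i u = Some v -> component c u <-> component c v.
Proof.
move=> uv; have suv : clos_refl_sym_trans word arrow u v.
  by apply: rst_step; exists i.
split=> ?; first exact: rst_trans suv.
by apply: rst_trans (rst_sym _ _ _ _ suv).
Qed.

Lemma component_et i c u v : et i u = Some v -> component c u <-> component c v.
Proof. by move/etP/component_ft=> H; apply: iff_sym. Qed.

Lemma component_ind (P : word -> Prop) c :
    P c -> (forall i u v, P u -> ft i u = Some v -> P v) ->
    (forall i u v, P u -> et i u = Some v -> P v) ->
  forall u, component c u -> P u.
Proof.
(* The closure is symmetric, so an equivalence is carried along the path; [etP] reverses arrows. *)
move=> Pc Pf Pe u cu; suff [H _] : P c <-> P u by apply: H.
elim: cu => {u Pc} [u v [i uv]|//|u v _|u v w _ -> _ //]; last exact: iff_sym.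
split=> H; first exact: Pf uv.
by move/etP: uv; apply: Pe.
Qed.

(** String lengths can be read off the operators alone, and the closure hypotheses keep the strings
    inside [A]. *)
Lemma iso_sig A B psi : crystal_iso A B psi ->
    (forall i u v, et i u = Some v -> A u -> A v) ->
    (forall i u v, ft i u = Some v -> A u -> A v) ->
  forall i u, A u -> sig i (psi u) = sig i u.
Proof.
move=> iso Ae Af i u Au; apply/eqP; rewrite -pair_eqE; apply/andP; split.
  elim: {u}(sig i u).1 {-2}u (erefl (sig i u).1) Au => [|n IH] u def_n Au.
    have /et_None eu := def_n.
    apply/eqP; rewrite def_n; apply/et_None.
    by rewrite (iso_et iso) // eu.
  case eu: (et i u) => [v|]; last by move/et_None: eu; rewrite def_n.
  have [e1 _ _] := spec_e (string_specP i u) eu.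
  have epu : et i (psi u) = Some (psi v) by rewrite (iso_et iso) // eu.
  have [-> _ _] := spec_e (string_specP i _) epu.
  rewrite e1 eqSS; apply: IH; last exact: Ae eu Au.
  by move: e1; rewrite def_n => -[].
elim: {u}(sig i u).2 {-2}u (erefl (sig i u).2) Au => [|n IH] u def_n Au.
  have /ft_None eu := def_n.
  apply/eqP; rewrite def_n; apply/ft_None.
  by rewrite (iso_ft iso) // eu.
case eu: (ft i u) => [v|]; last by move/ft_None: eu; rewrite def_n.
have [_ e1 _] := spec_f (string_specP i u) eu.
have epu : ft i (psi u) = Some (psi v) by rewrite (iso_ft iso) // eu.
have [_ -> _] := spec_f (string_specP i _) epu.
rewrite e1 eqSS; apply: IH; last exact: Af eu Au.
by move: e1; rewrite def_n => -[].
Qed.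

Lemma component_iso_sig c d psi : crystal_iso (component c) (component d) psi ->
  forall i u, component c u -> sig i (psi u) = sig i u.
Proof.
move=> iso; apply: (iso_sig iso) => i u v.
  by move/(component_et c)=> [].
by move/(component_ft c)=> [].
Qed.

Lemma plactic_iso_parallel c d psi u :
    crystal_iso (component c) (component d) psi ->
    (forall v, component c v -> plactic_rel v (psi v)) ->
  component c u -> parallel u (psi u).
Proof.
move=> iso H cu; split=> i; first by rewrite (component_iso_sig iso).
  rewrite (iso_et iso) //; case eu: (et i u) => [v|] //=.
  by apply/plactic_gen/H; have [] := component_et c eu; auto.
rewrite (iso_ft iso) //; case eu: (ft i u) => [v|] //=.
by apply/plactic_gen/H; have [] := component_ft c eu; auto.
Qed.

Lemma orel_sym a b : orel plactic a b -> orel plactic b a.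
Proof. by case: a b => [a|] [b|] //=; apply: plactic_sym. Qed.

Lemma orel_trans a b c :
  orel plactic a b -> orel plactic b c -> orel plactic a c.
Proof. by case: a b c => [a|] [b|] [c|] //=; apply: plactic_trans. Qed.

Lemma plactic_rel_parallel u v : plactic_rel u v -> parallel u v.
Proof.
case=> [||||||||xi w iso cw|xi w iso cw].
9: by apply: (plactic_iso_parallel iso _ cw) => y cy; apply: R3 iso cy.
9: by apply: (plactic_iso_parallel iso _ cw) => y cy; apply: R4 iso cy.
(* The seven pairs of (R1) form a copy of B(Lambda_1) and (R2) a trivial crystal: an operator kills
   both sides or leads to another pair of (R1). *)
all: split=> -[] //; vm_compute => //.
all: apply: plactic_gen; first [exact: R1_1 | exact: R1_2 | exact: R1_3
  | exact: R1_4 | exact: R1_5 | exact: R1_6 | exact: R1_7].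
Qed.

Lemma plactic_parallel u v : plactic u v -> parallel u v.
Proof.
elim=> {u v} [u v uv|u|u v _ [Hs He Hf]|u v w _ [Hs He Hf] _ [Hs' He' Hf']|].
- exact: plactic_rel_parallel.
- split=> i //; [case: et | case: ft] => //= ?; exact: plactic_refl.
- by split=> i; [rewrite Hs | apply: orel_sym | apply: orel_sym].
- split=> i; first by rewrite Hs.
    exact: orel_trans (He i) (He' i).
  exact: orel_trans (Hf i) (Hf' i).
- move=> u u' v v' uu' [Hs He Hf] vv' [Hs' He' Hf']; split=> i.
  + by rewrite !sig_cat Hs Hs'.
  + rewrite !et_cat Hs Hs'; case: ifP => _.
      case: (et i v) (et i v') (He' i) => [a|] [b|] //= ab.
      exact: plactic_cat.
    by case: (et i u) (et i u') (He i) => [a|] [b|] //= ab; exact: plactic_cat.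
  + rewrite !ft_cat Hs Hs'; case: ifP => _.
      case: (ft i u) (ft i u') (Hf i) => [a|] [b|] //= ab.
      exact: plactic_cat.
    by case: (ft i v) (ft i v') (Hf' i) => [a|] [b|] //= ab; exact: plactic_cat.
Qed.

(** * Highest weight words and induction by raising *)

Definition nodes := [:: node1; node2].

Definition highest (w : word) : Prop := forall i, (sig i w).1 = 0.

Lemma highest_or_et w : highest w \/ exists i w', et i w = Some w'.
Proof.
case e1: (et node1 w) => [w'|]; first by right; exists node1, w'.
case e2: (et node2 w) => [w'|]; first by right; exists node2, w'.
by left; case; apply/et_None.
Qed.

Lemma highest_cat u v :
  highest (u ++ v) <-> highest u /\ forall i, (sig i v).1 <= (sig i u).2.
Proof.
split=> [H|[Hu Hv] i]; last by rewrite sig_cat /= Hu; have := Hv i; lia.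
by split=> i; have := H i; rewrite sig_cat /=; lia.
Qed.

(* Every raising operator decreases this rank by one, whatever the node. *)
Definition rank_sum (w : word) : nat := sumn (map letter_code w).

Lemma et_rank_sum i w w' :
  et i w = Some w' -> rank_sum w = (rank_sum w').+1.
Proof.
elim: w w' => [|x v IH] //= w'; rewrite et_cons; case: ifP => _.
  case ev: (et i v) => [v'|] //= [<-].
  by rewrite /rank_sum /= -!/(rank_sum _) (IH _ ev) addnS.
by case: i x {IH} => [] [] //= [<-].
Qed.

Lemma raise_ind (P : word -> Prop) :
    (forall w, highest w -> P w) ->
    (forall i w w', et i w = Some w' -> P w' -> P w) ->
  forall w, P w.
Proof.
move=> Ph Pe w; have [n] := ubnP (rank_sum w).
elim: n w => // n IH w lt_n; have [/Ph//|[i [w' e]]] := highest_or_et w.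
by apply: (Pe _ _ _ e); apply: IH; rewrite (et_rank_sum e) in lt_n.
Qed.

Lemma component_refl c : component c c.
Proof. exact: rst_refl. Qed.

Lemma component_plactic u v w : plactic u v -> component u w ->
  exists2 w', component v w' & plactic w w'.
Proof.
move=> uv; move: w; apply: component_ind => [|i w1 w2|i w1 w2].
- by exists v => //; apply: component_refl.
- case=> w' vw' /plactic_parallel[_ _ /(_ i) H] e; move: H; rewrite e.
  case e': (ft i w') => [w''|] //= H.
  by exists w'' => //; apply/(component_ft v e').
case=> w' vw' /plactic_parallel[_ /(_ i) H _] e; move: H; rewrite e.
case e': (et i w') => [w''|] //= H.
by exists w'' => //; apply/(component_et v e').
Qed.

Lemma highest_plactic u v : plactic u v -> highest u -> highest v.
Proof. by move=> /plactic_parallel[H _ _] hu i; rewrite -H. Qed.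

(** * Crystal isomorphisms certified by finite computation *)

Definition orel_in (s : seq (word * word)) (a b : option word) : bool :=
  match a, b with
  | Some u, Some v => (u, v) \in s
  | None, None => true
  | _, _ => false
  end.

Definition parallel_closed (s : seq (word * word)) : bool :=
  all (fun p => all (fun i => orel_in s (et i p.1) (et i p.2)
                           && orel_in s (ft i p.1) (ft i p.2)) nodes) s.

(* The pairs reached by applying the same word of at most [n] lowering operators
   to [u] and [v]. *)
Definition parallel_strings (n : nat) (u v : word) : seq (word * word) :=
  let step (p : word * word) :=
    pmap (fun i => if (ft i p.1, ft i p.2) is (Some a, Some b)
                   then Some (a, b) else None) nodes in
  iter n (fun s => undup (s ++ flatten (map step s))) [:: (u, v)].

Lemma parallel_closedP s : parallel_closed s -> forall i u v, (u, v) \in s ->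
  orel_in s (et i u) (et i v) /\ orel_in s (ft i u) (ft i v).
Proof.
move/allP=> H i u v /H /= /and3P[/andP[e1 f1] /andP[e2 f2] _].
by case: i.
Qed.

Definition assoc_image (s : seq (word * word)) (u : word) : word :=
  nth [::] (unzip2 s) (index u (unzip1 s)).

Lemma assoc_imageP s u v :
  uniq (unzip1 s) -> (u, v) \in s -> assoc_image s u = v.
Proof.
move=> us /(nthP ([::], [::]))[k lt_k def_k].
have -> : u = nth [::] (unzip1 s) k by rewrite (nth_map ([::], [::])) ?def_k.
rewrite /assoc_image index_uniq ?size_map //.
by rewrite (nth_map ([::], [::])) ?def_k.
Qed.

(** A closed list follows every path from [u] in parallel from [v], so a finite computation controls
    a whole component. *)
Lemma parallel_closed_component s u v w :
    parallel_closed s -> (u, v) \in s -> component u w ->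
  exists2 w', (w, w') \in s & component v w'.
Proof.
move=> /parallel_closedP cs uv; move: w.
apply: component_ind => [|i w1 w2|i w1 w2].
- by exists v => //; apply: component_refl.
- case=> w' /(cs i)[_ H] vw' e; move: H; rewrite e.
  case e': (ft i w') => [w''|] //= H.
  by exists w'' => //; apply/(component_ft v e').
case=> w' /(cs i)[H _] vw' e; move: H; rewrite e.
case e': (et i w') => [w''|] //= H.
by exists w'' => //; apply/(component_et v e').
Qed.

Definition swap_pairs (s : seq (word * word)) := [seq (p.2, p.1) | p <- s].

(** The swapped list yields surjectivity; duplicate-free projections make the list the graph of a
    bijection. *)
Lemma parallel_closed_iso s u v :
    [&& parallel_closed s, parallel_closed (swap_pairs s), (u, v) \in s,
        uniq (unzip1 s) & uniq (unzip2 s)] ->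
  crystal_iso (component u) (component v) (assoc_image s)
  /\ assoc_image s u = v.
Proof.
case/and5P=> cs cs' uv us1 us2.
have in_swap a b : (a, b) \in s -> (b, a) \in swap_pairs s.
  exact: (map_f (fun p => (p.2, p.1))).
have swap_in a b : (b, a) \in swap_pairs s -> (a, b) \in s.
  by case/mapP=> -[c d] ? [-> ->].
have us2' : uniq (unzip1 (swap_pairs s)) by rewrite /unzip1 -map_comp.
have img a b : (a, b) \in s -> assoc_image s a = b by apply: assoc_imageP.
have inv a b : (a, b) \in s -> assoc_image (swap_pairs s) b = a.
  by move/in_swap; apply: assoc_imageP.
split; last exact: img.
have comp a : component u a ->
    (a, assoc_image s a) \in s /\ component v (assoc_image s a).
  by case/(parallel_closed_component cs uv)=> b sab vb; rewrite (img _ _ sab).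
split=> [a /comp[]//|a b /comp[/inv Ha _] /comp[/inv Hb _] ab|b vb
        |i a /comp[H _]|i a /comp[H _]].
- by rewrite -Ha -Hb ab.
- have [a /swap_in H ua] := parallel_closed_component cs' (in_swap _ _ uv) vb.
  by exists a => //; apply: img.
- have [+ _] := parallel_closedP cs i H.
  by case: et => [a'|]; case: et => [b'|] //= /img->.
have [_] := parallel_closedP cs i H.
by case: ft => [a'|]; case: ft => [b'|] //= /img->.
Qed.

Lemma plactic_121 : plactic [:: g1; g2; g1] [:: g1; g1; g2].
Proof.
(* Sixteen lowering steps lead from top to bottom of B(Lambda_1 + Lambda_2), so the list is
   complete. *)
have [|iso <-] := @parallel_closed_iso
  (parallel_strings 16 [:: g1; g2; g1] [:: g1; g1; g2])
  [:: g1; g2; g1] [:: g1; g1; g2]; first by vm_compute.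
by apply/plactic_gen/R3; last exact: component_refl.
Qed.

Lemma plactic_123 : plactic [:: g1; g2; g3] [:: g1; g1; g0].
Proof.
(* Here the crystal is B(2 Lambda_1), of depth 12. *)
have [|iso <-] := @parallel_closed_iso
  (parallel_strings 12 [:: g1; g2; g3] [:: g1; g1; g0])
  [:: g1; g2; g3] [:: g1; g1; g0]; first by vm_compute.
by apply/plactic_gen/R4; last exact: component_refl.
Qed.

(** * Reduction of highest weight words to canonical form *)

Definition canonical (a b : nat) : word :=
  flatten (nseq b [:: g1; g2]) ++ nseq a g1.

Lemma flatten_nseqSr (T : Type) b (w : seq T) :
  flatten (nseq b.+1 w) = flatten (nseq b w) ++ w.
Proof. by elim: b => [|b IH] /=; rewrite ?cats0 // -catA -IH. Qed.

(** The relation between 121 and 112 lets a letter 1 commute with each pair 12. *)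
Lemma plactic_swap_pairs a b :
  plactic (nseq a g1 ++ flatten (nseq b [:: g1; g2])) (canonical a b).
Proof.
have one b' : plactic ([:: g1] ++ flatten (nseq b' [:: g1; g2]))
                      (flatten (nseq b' [:: g1; g2]) ++ [:: g1]).
  elim: b' => [|b' IH] /=; first exact: plactic_refl.
  set D := flatten _ in IH *.
  have := plactic_cat (plactic_sym plactic_121) (plactic_refl D).
  move/plactic_trans; apply.
  exact: plactic_cat (plactic_refl [:: g1; g2]) IH.
rewrite /canonical; elim: a => [|a IH] /=.
  by rewrite cats0; apply: plactic_refl.
set D := flatten _ in IH one *.
have := plactic_cat (plactic_refl [:: g1]) IH; move/plactic_trans; apply.
rewrite catA; have := plactic_cat (one b) (plactic_refl (nseq a g1)).
by rewrite -[X in plactic _ X]catA.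
Qed.

Lemma canonical_rcons_pair a b :
  plactic (canonical a b ++ [:: g1; g2]) (canonical a b.+1).
Proof.
have := plactic_cat (plactic_sym (plactic_swap_pairs a b))
                    (plactic_refl [:: g1; g2]).
rewrite -catA -flatten_nseqSr => /plactic_trans; apply.
exact: plactic_swap_pairs.
Qed.

Lemma canonical_rcons_g1 a b : canonical a b ++ [:: g1] = canonical a.+1 b.
Proof.
rewrite /canonical -catA -[[:: g1]]/(nseq 1 g1) cat_nseq /ncons -iterD addn1.
by rewrite -/(ncons _ _ _).
Qed.

Lemma plactic_catl p u v : plactic u v -> plactic (p ++ u) (p ++ v).
Proof. exact: plactic_cat (plactic_refl p). Qed.

Lemma canonical_rcons_g2 a b :
  plactic (canonical a.+1 b ++ [:: g2]) (canonical a b.+1).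
Proof.
by rewrite -canonical_rcons_g1 -catA; apply: canonical_rcons_pair.
Qed.

Lemma canonical_rcons_cancel a b x w : plactic [:: g1; x] w ->
  plactic (canonical a.+1 b ++ [:: x]) (canonical a b ++ w).
Proof. by rewrite -canonical_rcons_g1 -catA; apply: plactic_catl. Qed.

Lemma canonical_rcons_pair_cancel a b x w : plactic [:: g1; g2; x] w ->
  plactic (canonical a b.+1 ++ [:: x]) (canonical a b ++ w).
Proof.
move=> H; apply: plactic_trans (plactic_catl _ H).
rewrite -[[:: _; _; x]]/([:: g1; g2] ++ [:: x]) catA.
apply: plactic_cat (plactic_refl _).
exact/plactic_sym/canonical_rcons_pair.
Qed.

(** The hypothesis says that the extended word is still of highest weight, so the truncated
    differences are exact. Every letter but 1 is absorbed by trailing letters 1 or a pair 12. *)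
Lemma canonical_rcons a b x :
    (forall i, depth i x <= (sig i (canonical a b)).2) ->
  plactic (canonical a b ++ [:: x])
    (canonical (height node1 x + (a - depth node1 x))
               (height node2 x + (b - depth node2 x))).
Proof.
have sg i : sig i (canonical a b) = (0, if i is node1 then a else b).
  have -> : canonical a b =
    flatten (nseq b [:: g1; g2]) ++ flatten (nseq a [:: g1]).
    by rewrite /canonical; congr (_ ++ _); elim: a => //= a <-.
  have one c w : (sig i w).1 = 0 ->
      sig i (flatten (nseq c w)) = (0, c * (sig i w).2).
    move=> w0; elim: c => //= c IH.
    by rewrite sig_cat IH w0 mulSn /=; congr pair; lia.
  by case: i one => one; rewrite sig_cat !one //=; congr pair; lia.
move=> H; move: (H node1) (H node2); rewrite !sg /= => {H sg}.
case: x => /=; rewrite ?subn0 ?add0n ?addn0 ?add1n => Ha Hb.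
- by rewrite canonical_rcons_g1; apply: plactic_refl.
- by case: a Ha => // a _; rewrite subn1; apply: canonical_rcons_g2.
(* Letter 3: 123 becomes 110, then 11. *)
- case: b Hb => // b _; rewrite subn1 !addSn -!canonical_rcons_g1 -catA.
  apply/canonical_rcons_pair_cancel/(plactic_trans plactic_123).
  exact: (plactic_catl [:: g1] (plactic_gen R1_1)).
- case: a Ha => // a _; rewrite subn1 /= -[X in plactic _ X]canonical_rcons_g1.
  exact/canonical_rcons_cancel/plactic_gen/R1_1.
(* Letter [g3b]: one trailing 1 turns it into 2, which forms a pair with a second 1. *)
- case: a Ha => [|[|a]] // _; rewrite subn2 /=.
  apply: plactic_trans (canonical_rcons_g2 a b).
  exact/canonical_rcons_cancel/plactic_gen/R1_2.
- case: b Hb => // b _; rewrite subn1 /= -[X in plactic _ X]canonical_rcons_g1.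
  apply/canonical_rcons_pair_cancel/(plactic_trans _ (plactic_gen R1_1)).
  exact: (plactic_catl [:: g1] (plactic_gen R1_4)).
- case: a Ha => // a _; rewrite subn1 /= -[X in plactic _ X]cats0.
  exact/canonical_rcons_cancel/plactic_gen/R2.
Qed.

(** At a highest weight vertex the [phi] values are the coordinates of the weight, hence the
    exponents. *)
Lemma highest_plactic_canonical w :
  highest w -> plactic w (canonical (sig node1 w).2 (sig node2 w).2).
Proof.
elim/last_ind: w => [_|u x IH]; first exact: plactic_refl.
rewrite -cats1 => /highest_cat[Hu Hx].
have uc := IH Hu; have [su _ _] := plactic_parallel uc.
have := plactic_cat uc (plactic_refl [:: x]); move/plactic_trans; apply.
rewrite !sig_cat /= !sub0n !addn0 !subn0 ?add0n.
by apply: canonical_rcons => i; rewrite -su; have := Hx i; rewrite /= addn0.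
Qed.

(** * Block structure of the component of a canonical word *)

(* [block 0] is empty and serves as a sentinel before the first block. *)
Definition block (n : nat) : word := take n [:: g1; g2].

(** For blocks of at most two letters, this is membership in the Cartan component of a tensor
    product of two crystals among the trivial one, B(Lambda_1) and B(Lambda_2). *)
Definition linked (x y : word) : Prop :=
  component (block (size x) ++ block (size y)) (x ++ y).

Fixpoint linked_from (x : word) (bs : seq word) : Prop :=
  if bs is y :: bs' then linked x y /\ linked_from y bs' else True.

(* An operator acting on a block of the word also acts on that block inside each
   of the two pairs of consecutive blocks containing it. *)
Lemma linked_from_ft i x bs w :
    linked_from x bs -> ft i (x ++ flatten bs) = Some w ->
  (exists x', [/\ w = x' ++ flatten bs, ft i x = Some x',
                  (sig i (flatten bs)).1 < (sig i x).2 & linked_from x' bs]) \/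
  (exists bs', [/\ w = x ++ flatten bs', linked_from x bs'
                 & map size bs' = map size bs]).
Proof.
elim: bs x w => [|y bs IH] x w /=.
  move=> _; rewrite cats0 => xw; left; exists w; rewrite cats0; split=> //.
  by have [_ ->] := spec_f (string_specP i x) xw.
case=> Lxy Ly; rewrite ft_cat; case: ifP => c.
  case ex: (ft i x) => [x'|] //= [<-]; left; exists x'; split=> //; split=> //.
  rewrite /linked (ft_size ex); apply: (@component_ft i _ _ _ _).1 Lxy.
  by rewrite ft_cat ex ifT //; move: c; rewrite sig_cat /=; lia.
case e: (ft i _) => [w'|] //= [<-]; right.
have [[y' [-> ey c' Ly']]|[bs' [-> Ly' sz]]] := IH _ _ Ly e; last first.
  by exists (y :: bs'); rewrite /= sz.
exists (y' :: bs); rewrite /= (ft_size ey); split=> //; split=> //.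
(* By [c'], what follows [y] does not change its [eps], so the comparison with [x] is the same in
   the pair alone. *)
rewrite /linked (ft_size ey); apply: (@component_ft i _ _ _ _).1 Lxy.
by rewrite ft_cat ey ifF //; move: c; rewrite sig_cat /=; lia.
Qed.

Lemma linked_from_et i x bs w :
    linked_from x bs -> et i (x ++ flatten bs) = Some w ->
  (exists x', [/\ w = x' ++ flatten bs, et i x = Some x',
                  (sig i (flatten bs)).1 <= (sig i x).2 & linked_from x' bs]) \/
  (exists bs', [/\ w = x ++ flatten bs', linked_from x bs'
                 & map size bs' = map size bs]).
Proof.
elim: bs x w => [|y bs IH] x w /=.
  by move=> _; rewrite cats0 => xw; left; exists w; rewrite cats0.
case=> Lxy Ly; rewrite et_cat; case: ifP => c; last first.
  case ex: (et i x) => [x'|] //= [<-]; left; exists x'; split=> //; first lia.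
  split=> //.
  rewrite /linked (et_size ex); apply: (@component_et i _ _ _ _).1 Lxy.
  by rewrite et_cat ex ifF //; move: c; rewrite sig_cat /=; lia.
case e: (et i _) => [w'|] //= [<-]; right.
have [[y' [-> ey c' Ly']]|[bs' [-> Ly' sz]]] := IH _ _ Ly e; last first.
  by exists (y :: bs'); rewrite /= sz.
exists (y' :: bs); rewrite /= (et_size ey); split=> //; split=> //.
rewrite /linked (et_size ey); apply: (@component_et i _ _ _ _).1 Lxy.
by rewrite et_cat ey ifT //; move: c; rewrite sig_cat /=; lia.
Qed.

Lemma component_linked ns w : all (fun n => n <= 2) ns ->
    component (flatten (map block ns)) w ->
  exists bs, [/\ w = flatten bs, linked_from [::] bs & map size bs = ns].
Proof.
move=> ns2; move: w; apply: component_ind => [|i u v|i u v].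
- have sz n : n <= 2 -> size (block n) = n by case: n => [|[|[|]]].
  have link m : m <= 2 -> linked_from (block m) (map block ns).
    elim: ns ns2 m => //= n ns IH /andP[n2 ns2] m m2; split; last by apply: IH.
    by rewrite /linked !sz //; apply: component_refl.
  exists (map block ns); split=> //; first exact: (link 0).
  by elim: ns ns2 {link} => //= n ns IH /andP[/sz-> /IH->].
- case=> bs [-> Lbs <-] e.
  (* No operator acts on the empty sentinel, which excludes the first alternative. *)
  by have [[x' [_]]|[bs' [-> ]]] := linked_from_ft (x := [::]) Lbs e;
    [|exists bs'].
case=> bs [-> Lbs <-] e.
by have [[x' [_]]|[bs' [-> ]]] := linked_from_et (x := [::]) Lbs e;
  [|exists bs'].
Qed.

(** Adjacent entries in the sequences 0, 2, ..., 2, 1, ..., 1. *)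
Definition consecutive_sizes : seq (nat * nat) :=
  [:: (0, 2); (0, 1); (2, 2); (2, 1); (1, 1)].

Definition follows (m n : nat) : bool := (m, n) \in consecutive_sizes.

(* The nodes [i] such that phi_i surely vanishes on a word (12)...(12)1...1 whose last
   block has [m] letters; [m = 0] stands for the empty word. *)
Definition killed (m : nat) (i : node) : bool :=
  match i with node1 => (m == 0) || (m == 2) | node2 => m == 0 end.

(** The bound 20 is the depth of B(2 Lambda_2), the largest of the five cases. *)
Definition cartan_strings (m n : nat) : seq (word * word) :=
  let hw := block m ++ block n in parallel_strings 20 hw hw.

Definition cartan_check (m n : nat) : bool :=
  let hw := block m ++ block n in
  [&& parallel_closed (cartan_strings m n), (hw, hw) \in cartan_strings m n
    & all (fun p =>
        let y := drop (size (block m)) p.1 in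
        [|| take (size (block m)) p.1 != block m, y == block n,
            killed m node1 && (0 < (sig node1 y).1)
          | killed m node2 && (0 < (sig node2 y).1)])
        (cartan_strings m n)].

Lemma cartan_checkT m n : follows m n -> cartan_check m n.
Proof.
have /allP H : all (fun mn => cartan_check mn.1 mn.2) consecutive_sizes.
  by vm_compute.
by move/H.
Qed.

Lemma linked_highest m y : follows m (size y) -> linked (block m) y ->
    (forall i, killed m i -> (sig i y).1 = 0) ->
  y = block (size y).
Proof.
move=> mn L H; have m2 : block (size (block m)) = block m.
  by case: m {mn L H} => [|[|[|]]].
move: L; rewrite /linked m2.
have := cartan_checkT mn; rewrite /cartan_check.
move: (cartan_strings _ _) => s /and3P[cs hw /allP ok].
case/(parallel_closed_component cs hw)=> w' /ok + _.
rewrite [(_, _).1]/= take_size_cat // drop_size_cat // eqxx.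
by case/or4P=> // [/eqP|/andP[/H->]|/andP[/H->]].
Qed.

(** Blocks are forced from left to right: where [phi] vanishes on [p], highest weight forbids a
    positive [eps] of the next block, and the finite check applies. *)
Lemma linked_from_highest p m bs :
    path follows m (map size bs) -> linked_from (block m) bs ->
    highest (p ++ flatten bs) ->
    (forall i, killed m i -> (sig i p).2 = 0) ->
  bs = map block (map size bs).
Proof.
elim: bs p m => //= y bs IH p m /andP[mn pbs] [Ly Lbs] hp kill.
have yE : y = block (size y).
  apply: linked_highest mn Ly _ => i ki.
  have [_ /(_ i)] := (highest_cat p _).1 hp.
  by rewrite (kill _ ki) sig_cat /=; lia.
congr (_ :: _); first by [].
apply: (IH (p ++ y) (size y)) => //; rewrite -?yE // -?catA // => i ki.
rewrite sig_cat /=; have -> : (sig i y).2 = 0.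
  by rewrite yE; case: i ki {kill} mn => //; case: (size y) => [|[|[|]]].
(* A node killed after [y] was killed before it: a block of size 2 only follows sizes 0 and 2, both
   of which kill [node1]. *)
suff -> : (sig i p).2 = 0 by [].
apply: kill; move: mn ki.
by case: i; case: m {Ly} => [|[|[|m]]] //; case: (size y) => [|[|[|n]]].
Qed.

Lemma canonical_highest_unique a b w :
  component (canonical a b) w -> highest w -> w = canonical a b.
Proof.
have canE : canonical a b = flatten (map block (nseq b 2 ++ nseq a 1)).
  rewrite /canonical map_cat flatten_cat !map_nseq; congr (_ ++ _).
  by elim: a => //= a <-.
rewrite canE => cw hw.
have [|bs [def_w Lbs sz]] := component_linked _ cw.
  by rewrite all_cat !all_nseq !orbT.
rewrite def_w; congr flatten; rewrite -sz.
apply: (@linked_from_highest [::] 0) => //; last by rewrite -def_w.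
rewrite sz; case: b {canE cw sz} => [|b] /=.
  case: a => //= a; by elim: a.
by elim: b => //=; case: a => //= a; elim: a.
Qed.

(** * Uniqueness of the highest weight vertex *)

Lemma component_rcons u x w : component (u ++ [:: x]) w ->
  exists u' x', w = u' ++ [:: x'] /\ component u u'.
Proof.
move: w; apply: component_ind => [|i v w|i v w].
- by exists u, x; split=> //; apply: component_refl.
- case=> u' [x' [-> cu]]; rewrite ft_cat; case: ifP => _.
    case e: (ft i u') => [u''|] //= [<-]; exists u'', x'; split=> //.
    exact/(component_ft u e).
  rewrite ft_cons /=; case: ifP => // _.
  by case: (letter_f i x') => [y|] //= [<-]; exists u', y.
case=> u' [x' [-> cu]]; rewrite et_cat; case: ifP => _; last first.
  case e: (et i u') => [u''|] //= [<-]; exists u'', x'; split=> //.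
  exact/(component_et u e).
by rewrite et_cons /=; case: (letter_e i x') => [y|] //= [<-];
  exists u', y.
Qed.

Lemma highest_unique h h' :
  highest h -> highest h' -> component h h' -> h = h'.
Proof.
elim/last_ind: h h' => [|u x IH] h' Hh Hh' ch.
  have -> // : h' = [::].
  by move: h' ch {Hh Hh'}; apply: component_ind => [|i w w' ->|i w w' ->].
rewrite -cats1 in Hh ch *.
have [u' [x' [def_h' cu]]] := component_rcons ch; rewrite {}def_h' in Hh' ch *.
have [[Hu Hx] [Hu' Hx']] := ((highest_cat _ _).1 Hh, (highest_cat _ _).1 Hh').
move: (IH _ Hu Hu' cu) Hh' Hx' ch => <- {u' Hu' cu} Hh' Hx' ch.
have hc := highest_plactic_canonical Hh.
(* The second word is carried into the canonical component, where uniqueness is known. *)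
have [w cw h'w] := component_plactic hc ch.
have def_w := canonical_highest_unique cw (highest_plactic h'w Hh').
rewrite {}def_w in h'w.
have [sg _ _] := plactic_parallel (plactic_trans hc (plactic_sym h'w)).
(* The seven letters have distinct weights; the highest weight bounds rule out truncation in the
   subtractions. *)
congr (_ ++ [:: _]); move: (congr1 snd (sg node1)) (congr1 snd (sg node2)).
rewrite !sig_cat.
move: (Hx node1) (Hx node2) (Hx' node1) (Hx' node2).
by case: x {Hx Hh ch sg hc cw h'w} => /=; case: x' {Hx' Hh'} => //= *; lia.
Qed.

(** The same operators raise both words to highest weight, where [highest_unique] applies; lowering
    back preserves equality. *)
Lemma plactic_component_eq a b : plactic a b -> component a b -> a = b.
Proof.
elim/raise_ind: a b => [a ha|i a a' ea IH] b ab cab.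
  exact: highest_unique (highest_plactic ab ha) cab.
have [_ /(_ i) + _] := plactic_parallel ab; rewrite ea.
case eb: (et i b) => [b'|] //= ab'.
have def_b : b' = a'.
  apply/esym/IH => //; apply/(component_et _ eb).
  by apply: rst_trans cab; apply: rst_step; exists i; apply/etP.
by move/etP: eb; move/etP: ea; rewrite def_b => -> [].
Qed.

(** * The two implications between crystal equivalence and congruence *)

Lemma component_component c u v :
  component c u -> component c v -> component u v.
Proof. by move=> cu cv; apply: rst_trans (rst_sym _ _ _ _ cu) cv. Qed.

Lemma plactic_crystal_eq w1 w2 : plactic w1 w2 -> crystal_eq w1 w2.
Proof.
move=> w12.
pose good u v := component w2 v /\ plactic u v.
(* On the component of [w1], a good vertex exists by transporting paths and is unique by
   [plactic_component_eq]. *)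
pose psi u := epsilon (inhabits [::]) (good u).
have psiP u : component w1 u -> good u (psi u).
  move=> /(component_plactic w12)[v cv uv].
  by apply: epsilon_spec; exists v.
have uniq u v v' : good u v -> good u v' -> v = v'.
  case=> cv uv [cv' uv']; apply: plactic_component_eq.
    exact: plactic_trans (plactic_sym uv) uv'.
  exact: component_component cv cv'.
have psiE u v : component w1 u -> good u v -> psi u = v.
  by move=> /psiP; apply: uniq.
exists psi; last by apply: psiE; [|split]; try exact: component_refl.
split=> [u /psiP[]//|u v cu cv e|v cv|i u cu|i u cu].
- apply: plactic_component_eq; last exact: component_component cu cv.
  have [_ uv] := psiP _ cu; have [_ vv] := psiP _ cv.
  by apply: plactic_trans uv _; rewrite e; apply: plactic_sym.
- have [u cu vu] := component_plactic (plactic_sym w12) cv.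
  by exists u => //; apply: psiE => //; split=> //; apply: plactic_sym.
- have [cpu /plactic_parallel[_ /(_ i) + _]] := psiP _ cu.
  case eu: (et i u) => [u'|]; case ev: (et i (psi u)) => [v'|] //= uv.
  congr Some; apply/esym/psiE; first exact/(component_et _ eu).
  by split=> //; apply/(component_et _ ev).
have [cpu /plactic_parallel[_ _ /(_ i)]] := psiP _ cu.
case eu: (ft i u) => [u'|]; case ev: (ft i (psi u)) => [v'|] //= uv.
congr Some; apply/esym/psiE; first exact/(component_ft _ eu).
by split=> //; apply/(component_ft _ ev).
Qed.

Lemma crystal_eq_plactic w1 w2 : crystal_eq w1 w2 -> plactic w1 w2.
Proof.
(* The claim is generalised to every vertex of the component of [w1], with [psi] fixed. *)
case=> psi iso <-; move: (component_refl w1); move: {2 3 4}w1.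
elim/raise_ind => [w hw|i w w' ew IH] cw.
  have sg i : sig i (psi w) = sig i w by apply: (component_iso_sig iso).
  apply: plactic_trans (highest_plactic_canonical hw) _.
  apply: plactic_sym; rewrite -(sg node1) -(sg node2).
  by apply: highest_plactic_canonical => i; rewrite sg.
have cw' : component w1 w' by apply/(component_et _ ew).
(* Lowering the congruent words [w'] and [psi w'] along [i] gives [w] and [psi w]. *)
have /plactic_parallel[_ _ /(_ i)] := IH cw'.
by rewrite (iso_ft iso) //; move/etP: ew => ->.
Qed.

Theorem theorem3p1p4 : forall w1 w2 : word,
  crystal_eq w1 w2 <-> plactic w1 w2.
Proof.
by move=> w1 w2; split; [apply: crystal_eq_plactic|apply: plactic_crystal_eq].
Qed.
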